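(* Let $(\alpha_0(n))_{n\ge1}$ and $(\alpha_1(n))_{n\ge1}$ be bounded convergent real sequences such that, for all $n$, $$2\alpha_0(n)+\alpha_1(n)=1\qquad\text{and}\qquad \big(\alpha_0(n)<0\ \text{ or }\ \alpha_0(n)+\alpha_1(n)<0\big),$$ and let $l_0=\lim_{n\to\infty}\alpha_0(n)$. Let $U_n^{1}$ be the associated modified genuine Bernstein-Durrmeyer operator. If $f\in C[0,1]$ and $f''$ exists at a certain point $x\in[0,1]$, then $$\lim_{n\to\infty} n\left(U_n^{1}(f;x)-f(x)\right)=(1-2x)(1-l_0)f'(x)+x(1-x)f''(x).$$ Moreover, this relation holds uniformly on $[0,1]$ if $f''\in C[0,1]$.
   Context: For integers $m\ge 0$ and $0\le k\le m$, let $p_{m,k}(x)=\binom{m}{k}x^k(1-x)^{m-k}$, $x\in[0,1]$. Given real sequences $\alpha_0(n),\alpha_1(n)$, put $\alpha(x,n)=\alpha_1(n)x+\alpha_0(n)$. The modified genuine Bernstein-Durrmeyer operator is $$U_n^{1}(f;x)=\alpha(x,n)(1-x)^{n-1}f(0)+\alpha(1-x,n)x^{n-1}f(1)+(n-1)\sum_{k=1}^{n-1}\left\{\alpha(x,n)p_{n-1,k}(x)+\alpha(1-x,n)p_{n-1,k-1}(x)\right\}\int_0^1 p_{n-2,k-1}(t)f(t)\,dt,$$ for $x\in[0,1]$, where the empty sum (case $n=1$) is $0$ and $0^0=1$. The condition $2\alpha_0(n)+\alpha_1(n)=1$ expresses that $U_n^1$ maps the constant function $1$ to itself. *)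

(* Defs.v *)
From mathcomp Require Import all_boot all_order all_algebra.
From mathcomp Require Import all_classical all_reals all_analysis.
Set Implicit Arguments.
Unset Strict Implicit.
Unset Printing Implicit Defensive.
Import Order.TTheory GRing.Theory Num.Theory.
Import numFieldNormedType.Exports.
Local Open Scope classical_set_scope.
Local Open Scope ring_scope.

Definition bernstein_poly (R : realType) (m k : nat) (x : R) : R :=
  'C(m, k)%:R * x ^+ k * (1 - x) ^+ (m - k).

Definition alpha_fun (R : realType) (alpha0 alpha1 : nat -> R) (x : R) (n : nat) : R :=
  alpha1 n * x + alpha0 n.

(* Meaningful for [0 < n]; the indices [n.-2] and [k.-1] are then never
   truncated, since the sum is empty for [n = 1]. *)
Definition genuine_durrmeyer1 (R : realType) (alpha0 alpha1 : nat -> R)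
    (n : nat) (f : R -> R) (x : R) : R :=
  alpha_fun alpha0 alpha1 x n * (1 - x) ^+ n.-1 * f 0
  + alpha_fun alpha0 alpha1 (1 - x) n * x ^+ n.-1 * f 1
  + n.-1%:R * \sum_(1 <= k < n)
      (alpha_fun alpha0 alpha1 x n * bernstein_poly n.-1 k x
       + alpha_fun alpha0 alpha1 (1 - x) n * bernstein_poly n.-1 k.-1 x)
      * \int[@lebesgue_measure R]_(t in `[0, 1]) (bernstein_poly n.-2 k.-1 t * f t).

(* Differentiation relative to a set [A]: increments stay in [A], so that for
   [A = `[0, 1]] the derivative is one-sided at the endpoints, and the values
   of [f] outside [A] play no role. *)
Definition diff_quotient (R : realType) (f : R -> R) (x y : R) : R :=
  (f y - f x) / (y - x).

Definition derivable_in (R : realType) (A : set R) (f : R -> R) (x : R) : Prop :=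
  cvg (diff_quotient f x y @[y --> within A x^']).

Definition derive_in (R : realType) (A : set R) (f : R -> R) (x : R) : R :=
  lim (diff_quotient f x y @[y --> within A x^']).

Definition derivable2_in (R : realType) (A : set R) (f : R -> R) (x : R) : Prop :=
  (\forall y \near within A (nbhs x), derivable_in A f y)
  /\ derivable_in A (derive_in A f) x.

Definition derive2_in (R : realType) (A : set R) (f : R -> R) : R -> R :=
  derive_in A (derive_in A f).

(* Main.v *)
Require Import Defs.
From mathcomp Require Import all_boot all_order all_algebra.
From mathcomp Require Import all_classical all_reals all_analysis.
From mathcomp Require Import ring lra.
Set Implicit Arguments.
Unset Strict Implicit.
Unset Printing Implicit Defensive.
Import Order.TTheory GRing.Theory Num.Theory.
Import numFieldNormedType.Exports.
Local Open Scope classical_set_scope.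
Local Open Scope ring_scope.

(** The operator need not be positive, but it is a combination with bounded
    coefficients of two positive operators, and for these the classical proof
    of a Voronovskaya formula goes through.

    Let [L_k], for [0 <= k <= n], be the functionals of the genuine
    Bernstein-Durrmeyer operator ([node_functional]): the values at the
    endpoints for [k = 0, n], and a Beta(k, n - k) average otherwise. They are
    positive and [L_k (t^i) = k (k+1) ... (k+i-1) / (n (n+1) ... (n+i-1))]
    for every [k], the endpoints included ([node_moment]). Put
    [V_s f = E (L_(K+s) f)] with [K] binomial of parameters [n - 1, x]
    ([shifted_mean]). Then [U_n f = a V_0 f + b V_1 f] with
    [a = alpha(x, n)], [b = alpha(1 - x, n)] and [a + b = 1]
    ([genuine_durrmeyer1E]).

    The factorial moments of [K] are [(n-1)^_i x^i], so the moments of [V_s]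
    about [x] are explicit rational functions of [n]: the first is
    [(s - x) / n], the second is [2 x (1 - x) / n + O(1/n^2)] and the fourth is
    [O(1/n^2)], uniformly in [x]. The combination of the first moments,
    [- a x + b (1 - x) = (1 - 2x) (1 - alpha0 n)], produces the coefficient of
    [f'], and the second moments produce [x (1 - x) f'']. If the second order
    Taylor remainder at [x] is at most [e (t-x)^2 + M (t-x)^4], the positivity
    of [V_0] and [V_1] bounds its contribution to [n (U_n f - f)] by
    [C (30 e + 2400 M / n)] ([genuine_durrmeyer1_voronovskaya_bound]).

    Such a remainder bound, with [e] as small as desired, holds near [x] by
    the mean value theorem, and away from [x] because [f] is bounded and
    [(t-x)^4] is bounded below. It holds at one point [x] when [f''(x)] exists,
    and with the same constants at all [x] when [f''] is continuous, hence
    uniformly continuous. One statement over a set [S] of points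
    ([genuine_durrmeyer1_voronovskaya_on]) therefore gives both claims, with
    [S] a singleton and [S = [0, 1]]. *)

(** * Binomial means and their factorial moments *)

Section BernsteinMean.
Context {R : realType}.
Implicit Types (m i j k : nat) (x : R) (g h : nat -> R).

Lemma bernstein_poly_ge0 m k x : 0 <= x <= 1 -> 0 <= bernstein_poly m k x.
Proof.
move=> /andP[x0 x1]; rewrite /bernstein_poly.
by rewrite !mulr_ge0 ?exprn_ge0 ?ler0n ?subr_ge0.
Qed.

Definition bernstein_mean m x g : R :=
  \sum_(j < m.+1) bernstein_poly m j x * g j.

Lemma bernstein_meanD m x g h :
  bernstein_mean m x (fun j => g j + h j)
  = bernstein_mean m x g + bernstein_mean m x h.
Proof. by rewrite -big_split; apply: eq_bigr => j _; rewrite mulrDr. Qed.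

Lemma bernstein_meanZ m x c g :
  bernstein_mean m x (fun j => c * g j) = c * bernstein_mean m x g.
Proof. by rewrite big_distrr; apply: eq_bigr => j _ /=; rewrite mulrCA. Qed.

Lemma eq_bernstein_mean m x g h : (forall j, (j <= m)%N -> g j = h j) ->
  bernstein_mean m x g = bernstein_mean m x h.
Proof. by move=> gh; apply: eq_bigr => j _; rewrite gh// -ltnS. Qed.

Lemma ler_norm_bernstein_mean m x g h : 0 <= x <= 1 ->
  (forall j, (j <= m)%N -> `|g j| <= h j) ->
  `|bernstein_mean m x g| <= bernstein_mean m x h.
Proof.
move=> x01 gh; apply: le_trans (ler_norm_sum _ _ _) _.
apply: ler_sum => j _; have b0 := bernstein_poly_ge0 m j x01.
by rewrite normrM ger0_norm// ler_wpM2l// gh// -ltnS.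
Qed.

(** Pascal's rule for the weights: conditioning a sum of [m + 1] Bernoulli
    trials on one of them. *)
Lemma bernstein_meanS m x g :
  bernstein_mean m.+1 x g
  = (1 - x) * bernstein_mean m x g + x * bernstein_mean m x (fun j => g j.+1).
Proof.
rewrite /bernstein_mean big_ord_recl /= /bump/=.
under eq_bigr do rewrite add1n.
rewrite [X in (1 - x) * X]big_ord_recl /=.
rewrite /bump; under [X in (1 - x) * (_ + X)]eq_bigr do rewrite /= add1n.
have E j : (j < m.+1)%N -> bernstein_poly m.+1 j.+1 x =
    (1 - x) * bernstein_poly m j.+1 x + x * bernstein_poly m j x.
  rewrite ltnS leq_eqVlt => /orP[/eqP->|jm]; rewrite /bernstein_poly.
    by rewrite !binn bin_small// !subnn exprS; ring.
  rewrite binS subSS natrD.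
  have -> : (m - j = (m - j.+1).+1)%N by rewrite subnSK.
  by rewrite !exprS; ring.
transitivity ((1 - x) * (bernstein_poly m 0 x * g 0) +
   \sum_(i < m.+1) ((1 - x) * (bernstein_poly m i.+1 x * g i.+1) +
     x * (bernstein_poly m i x * g i.+1))).
  congr (_ + _); last by apply: eq_bigr => j _; rewrite E//; ring.
  by rewrite /bernstein_poly !bin0 !subn0 exprS; ring.
rewrite big_split/= -!big_distrr/= addrA; congr (_ + _).
rewrite mulrDr; congr (_ + _ * _).
rewrite big_ord_recr/= [bernstein_poly m m.+1 x]/bernstein_poly bin_small//.
by rewrite !mul0r addr0.
Qed.

(** The factorial moments of a binomial variable. By induction on [m], the step
    being [(k+1)^_(i+1) = k^_(i+1) + (i+1) k^_i]. *)
Lemma bernstein_mean_ffact m i x :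
  bernstein_mean m x (fun j => (j ^_ i)%:R) = (m ^_ i)%:R * x ^+ i.
Proof.
elim: m i => [|m IH] i.
  rewrite /bernstein_mean big_ord1 /bernstein_poly bin0 !expr0 !mul1r ffact0n.
  by case: i => [|i] /=; rewrite ?expr0 ?mulr1 ?mul0r.
rewrite bernstein_meanS IH; case: i => [|i].
  by rewrite (IH 0%N) !ffactn0 expr0; ring.
have pascal k :
    (k.+1 ^_ i.+1)%:R = (k ^_ i.+1)%:R + i.+1%:R * (k ^_ i)%:R :> R.
  rewrite -natrM -natrD; congr _%:R; rewrite ffactSS ffactnSr.
  have [ik|ki] := leqP i k; last by rewrite ffact_small// !muln0.
  by rewrite mulnC (mulnC i.+1) -mulnDr addnS subnK.
rewrite (@eq_bernstein_mean _ _ _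
  (fun k => (k ^_ i.+1)%:R + i.+1%:R * (k ^_ i)%:R)); last by move=> k _.
rewrite bernstein_meanD bernstein_meanZ !IH pascal exprS.
by ring.
Qed.

End BernsteinMean.

(** * The functionals of the genuine Bernstein-Durrmeyer operator *)

Section Node.
Context {R : realType}.
Notation mu := (@lebesgue_measure R).
Implicit Types (m n i j k : nat) (x : R) (f g : R -> R).

(** Genuine Bernstein-Durrmeyer functionals. The endpoint evaluations are the
    limits of the Beta(k, n - k) averages when a parameter tends to [0], so
    that the moment formula has no exception. *)
Definition node_functional n k f : R :=
  if (k == 0)%N then f 0 else if (k == n)%N then f 1 else
  n.-1%:R * \int[mu]_(t in `[0, 1]) (bernstein_poly n.-2 k.-1 t * f t).

Lemma bernstein_poly_integrable m k f : {within `[0, 1], continuous f} ->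
  mu.-integrable `[0, 1] (EFin \o (fun t => bernstein_poly m k t * f t)).
Proof.
move=> fc; apply: continuous_compact_integrable; first exact: segment_compact.
move=> /= t; apply: continuousM; last exact: fc.
have -> : bernstein_poly m k = fun t : R => 'C(m, k)%:R * XMonemX k (m - k) t.
  by apply/funext => u; rewrite /bernstein_poly -mulrA.
apply: continuous_subspaceT => {}t.
by apply: cvgM; [exact: cvg_cst|exact: continuous_XMonemX].
Qed.

Lemma node_functionalD n k f g :
  {within `[0, 1], continuous f} -> {within `[0, 1], continuous g} ->
  node_functional n k (fun t => f t + g t)
  = node_functional n k f + node_functional n k g.
Proof.
move=> fc gc; rewrite /node_functional; case: ifP => // _; case: ifP => // _.
rewrite -mulrDr -RintegralD//; [|exact: bernstein_poly_integrable..].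
by congr (_ * _); apply: eq_Rintegral => t _; rewrite mulrDr.
Qed.

Lemma node_functionalZ n k c f : {within `[0, 1], continuous f} ->
  node_functional n k (fun t => c * f t) = c * node_functional n k f.
Proof.
move=> fc; rewrite /node_functional; case: ifP => // _; case: ifP => // _.
rewrite [RHS]mulrCA -(RintegralZl c)//; last exact: bernstein_poly_integrable.
by congr (_ * _); apply: eq_Rintegral => t _; rewrite mulrCA.
Qed.

Lemma ler_node_functional n k f g :
  {within `[0, 1], continuous f} -> {within `[0, 1], continuous g} ->
  (forall t, 0 <= t <= 1 -> f t <= g t) ->
  node_functional n k f <= node_functional n k g.
Proof.
move=> fc gc fg; rewrite /node_functional; case: ifP => [_|_].
  by apply: fg; rewrite lexx ler01.
case: ifP => _; first by apply: fg; rewrite lexx ler01.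
rewrite ler_wpM2l// le_Rintegral//; try exact: bernstein_poly_integrable.
move=> t /=; rewrite in_itv/= => t01.
by rewrite ler_wpM2l ?bernstein_poly_ge0 ?fg.
Qed.

Lemma eq_node_functional n k f g : (forall t, 0 <= t <= 1 -> f t = g t) ->
  node_functional n k f = node_functional n k g.
Proof.
move=> fg; rewrite /node_functional; case: ifP => [_|_].
  by apply: fg; rewrite lexx ler01.
case: ifP => _; first by apply: fg; rewrite lexx ler01.
congr (_ * _); apply: eq_Rintegral => t.
by rewrite inE/= in_itv/= => t01; rewrite fg.
Qed.

(** Rising factorial [k (k+1) ... (k+i-1)]. *)
Definition rising k i : nat := \prod_(j < i) (k + j)%N.

Lemma fact_rising k i : (k + i)`! = (k`! * rising k.+1 i)%N.
Proof.
elim: i => [|i IH]; first by rewrite addn0 /rising big_ord0 muln1.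
by rewrite addnS factS IH /rising big_ord_recr/= addSn mulnCA
  (mulnC (k + i).+1).
Qed.

Lemma rising_gt0 k i : (0 < k)%N -> (0 < rising k i)%N.
Proof.
by move=> k0; rewrite /rising prodn_gt0// => j; rewrite addn_gt0 k0.
Qed.

(** At an interior node this is a ratio of Beta integrals; at [k = 0] both sides
    are the indicator of [i = 0], and at [k = n] both are [1]. *)
Lemma node_moment n k i : (0 < n)%N -> (k <= n)%N ->
  node_functional n k (fun t => t ^+ i) = (rising k i)%:R / (rising n i)%:R.
Proof.
move=> n0 kn; rewrite /node_functional; case: eqP => [->|/eqP k0].
  case: i => [|i]; first by rewrite /rising !big_ord0 expr0 divr1.
  by rewrite /rising big_ord_recl/= mul0n mul0r expr0n.
case: eqP => [->|/eqP nk].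
  by rewrite expr1n divff// pnatr_eq0 -lt0n rising_gt0.
case: k k0 kn nk => // k _ kn nk.
have {kn nk} : (k.+1 < n)%N by rewrite ltn_neqAle nk.
move=> /subnKC; set b := (n - k.+2)%N; rewrite !addSn => {n0} <-.
move: b => b /=.
have -> : \int[mu]_(t in `[0, 1]) (bernstein_poly (k + b) k t * t ^+ i) =
   'C(k + b, k)%:R * @beta_fun R (k + i).+1 b.+1.
  rewrite /beta_fun -Rintegral_mkcond -RintegralZl//=.
    apply: eq_Rintegral => t _; rewrite /bernstein_poly /XMonemX /unstable.onem.
    by rewrite addKn exprD; ring.
  exact: integrable_XMonemX.
rewrite beta_fun_fact.
have E1 : 'C(k + b, k)%:R = (k + b)`!%:R / (k`!%:R * b`!%:R) :> R.
  apply: (canRL (mulfK _)).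
    by rewrite mulf_neq0// pnatr_eq0 -lt0n fact_gt0.
  by rewrite -!natrM -(@bin_fact (k + b) k) ?leq_addr// addKn.
rewrite {}E1.
have E2 : ((k + i + b).+1)`! = ((k + b).+1 * (k + b)`! * rising (k + b).+2 i)%N.
  by rewrite -factS -fact_rising; congr (_`!); rewrite addSn addnAC.
rewrite {}E2 (fact_rising k i) !natrM.
have f0 j : (j`!%:R : R) != 0 by rewrite pnatr_eq0 -lt0n fact_gt0.
have r0 : (rising (k + b).+2 i)%:R != 0 :> R.
  by rewrite pnatr_eq0 -lt0n rising_gt0.
have n0 : ((k + b).+1%:R : R) != 0 by rewrite pnatr_eq0.
by field; rewrite r0 !f0 -natrD nat1r n0.
Qed.

End Node.

(** * Central moments of the two positive operators *)

Section Moments.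
Context {R : realType}.
Implicit Types (m n i j k s : nat) (x : R) (f g : R -> R).

(** The positive operators [V_0] and [V_1]; only the shifts [s = 0, 1] keep all
    nodes in [0 .. n]. *)
Definition shifted_mean n s x f : R :=
  bernstein_mean n.-1 x (fun j => node_functional n (j + s) f).

Lemma shifted_meanD n s x f g :
  {within `[0, 1], continuous f} -> {within `[0, 1], continuous g} ->
  shifted_mean n s x (fun t => f t + g t)
  = shifted_mean n s x f + shifted_mean n s x g.
Proof.
move=> fc gc; rewrite -bernstein_meanD; apply: eq_bernstein_mean => j _.
exact: node_functionalD.
Qed.

Lemma shifted_meanZ n s x c f : {within `[0, 1], continuous f} ->
  shifted_mean n s x (fun t => c * f t) = c * shifted_mean n s x f.
Proof.
move=> fc; rewrite -bernstein_meanZ; apply: eq_bernstein_mean => j _.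
exact: node_functionalZ.
Qed.

Lemma eq_shifted_mean n s x f g : (forall t, 0 <= t <= 1 -> f t = g t) ->
  shifted_mean n s x f = shifted_mean n s x g.
Proof.
by move=> fg; apply: eq_bernstein_mean => j _; exact: eq_node_functional.
Qed.

Lemma within_continuous_sum_expr (c : nat -> R) d :
  {within `[0, 1], continuous (fun t : R => \sum_(i < d) c i * t ^+ i)}.
Proof.
apply: continuous_subspaceT; elim: d => [|d IH] t.
  by under eq_fun do rewrite big_ord0; exact: cvg_cst.
under eq_fun do rewrite big_ord_recr/=.
apply: cvgD; first exact: IH.
by apply: cvgM; [exact: cvg_cst|exact: exprn_continuous].
Qed.

Definition shifted_moment n s x i : R :=
  bernstein_mean n.-1 x (fun j => (rising (j + s) i)%:R) / (rising n i)%:R.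

Lemma shifted_mean_expr n s x i : (0 < n)%N -> (s <= 1)%N ->
  shifted_mean n s x (fun t => t ^+ i) = shifted_moment n s x i.
Proof.
move=> n0 s1; rewrite /shifted_moment mulrC -bernstein_meanZ.
apply: eq_bernstein_mean => j jn; rewrite node_moment// 1?mulrC//.
by rewrite -(prednK n0) -addn1 leq_add.
Qed.

Lemma shifted_mean_poly n s x (c : nat -> R) d : (0 < n)%N -> (s <= 1)%N ->
  shifted_mean n s x (fun t => \sum_(i < d) c i * t ^+ i)
  = \sum_(i < d) c i * shifted_moment n s x i.
Proof.
move=> n0 s1; elim: d => [|d IH].
  rewrite big_ord0 (@eq_shifted_mean _ _ _ _ (fun t => 0 * 0)).
    rewrite shifted_meanZ ?mul0r//.
    by apply: continuous_subspaceT => t; exact: cvg_cst.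
  by move=> t _; rewrite big_ord0 mul0r.
rewrite big_ord_recr/= -IH -shifted_mean_expr//.
have cX : {within `[0, 1], continuous (fun t : R => t ^+ d)}.
  by apply: continuous_subspaceT; exact: exprn_continuous.
rewrite -(shifted_meanZ _ _ _ _ cX) -shifted_meanD.
- by apply: eq_shifted_mean => t _; rewrite big_ord_recr.
- exact: within_continuous_sum_expr.
- apply: continuous_subspaceT => t.
  by apply: cvgM; [exact: cvg_cst|exact: exprn_continuous].
Qed.

Lemma natr_ffactS k i : (k ^_ i.+1)%:R = (k ^_ i)%:R * (k%:R - i%:R) :> R.
Proof.
rewrite ffactnSr natrM; have [ik|ki] := leqP i k; first by rewrite natrB.
by rewrite ffact_small// !mul0r.
Qed.

Lemma bernstein_mean_ffact_sum m x (c : nat -> R) d :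
  bernstein_mean m x (fun j => \sum_(i < d) c i * (j ^_ i)%:R)
  = \sum_(i < d) c i * ((m ^_ i)%:R * x ^+ i).
Proof.
rewrite /bernstein_mean.
under eq_bigr do rewrite big_distrr/=.
rewrite exchange_big/=; apply: eq_bigr => i _.
by rewrite -bernstein_mean_ffact -bernstein_meanZ.
Qed.

(** Moments are read off from an expansion of the rising factorial in falling
    factorials, whose binomial means are known. *)
Lemma shifted_moment_ffact n s x i d (c : nat -> R) : (0 < n)%N ->
  (forall j, (rising (j + s) i)%:R = \sum_(l < d) c l * (j ^_ l)%:R) ->
  shifted_moment n s x i
  = (\sum_(l < d) c l * ((n.-1 ^_ l)%:R * x ^+ l)) / (rising n i)%:R.
Proof.
move=> n0 H; rewrite /shifted_moment -bernstein_mean_ffact_sum.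
by congr (_ / _); apply: eq_bernstein_mean => j _.
Qed.

Lemma shifted_moment0 n s x : (0 < n)%N -> shifted_moment n s x 0 = 1.
Proof.
move=> n0; rewrite (@shifted_moment_ffact _ _ _ _ 1 (fun=> 1))//.
  by rewrite /rising big_ord1 big_ord0 !ffactn0 expr0 !mulr1 divr1.
by move=> j; rewrite /rising big_ord1 big_ord0 !ffactn0 mulr1.
Qed.

(** Row [i] lists the coefficients of [(j + s) (j+s+1) ... (j+s+i-1)] in the
    basis [j^_l]: by the Chu-Vandermonde identity the [l]-th one is
    ['C(i, l)] times the rising factorial of [s + l] of length [i - l]. *)
Definition rising_ffact_coef (s i : nat) : seq R :=
  let sg := s%:R in
  nth [::] [:: [:: 1]; [:: sg; 1]; [:: sg * (sg + 1); 2 * (sg + 1); 1];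
     [:: sg * (sg + 1) * (sg + 2); 3 * (sg + 1) * (sg + 2); 3 * (sg + 2); 1];
     [:: sg * (sg + 1) * (sg + 2) * (sg + 3);
         4 * (sg + 1) * (sg + 2) * (sg + 3); 6 * (sg + 2) * (sg + 3);
         4 * (sg + 3); 1]] i.

Lemma natr_rising n i : (rising n i)%:R = \prod_(j < i) (n%:R + j%:R) :> R.
Proof. by rewrite /rising natr_prod; apply: eq_bigr => j _; rewrite natrD. Qed.

Lemma rising_ffactE s i j : (i <= 4)%N -> (rising (j + s) i)%:R
  = \sum_(l < i.+1) (rising_ffact_coef s i)`_l * (j ^_ l)%:R :> R.
Proof.
rewrite natr_rising natrD.
case: i => [|[|[|[|[|//]]]]] _; rewrite !(big_ord_recr, big_ord0)/=;
  rewrite ?natr_ffactS ?ffactn0; ring.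
Qed.

Lemma shifted_moment_explicit n s x i : (0 < n)%N -> (i <= 4)%N ->
  shifted_moment n s x i
  = (\sum_(l < i.+1) (rising_ffact_coef s i)`_l * ((n.-1 ^_ l)%:R * x ^+ l))
    / (rising n i)%:R.
Proof.
by move=> n0 i4; apply: shifted_moment_ffact => // j; exact: rising_ffactE.
Qed.

Lemma shifted_mean_sub n s x : (0 < n)%N -> (s <= 1)%N ->
  shifted_mean n s x (fun t => t - x) = (s%:R - x) / n%:R.
Proof.
move=> n0 s1.
rewrite (@eq_shifted_mean _ _ _ _
  (fun t => \sum_(i < 2) [:: - x; 1]`_i * t ^+ i)); last first.
  by move=> t _; rewrite !(big_ord_recr, big_ord0)/=; ring.
rewrite shifted_mean_poly// !(big_ord_recr, big_ord0)/=.
rewrite !shifted_moment_explicit//.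
rewrite !(big_ord_recr, big_ord0)/= !natr_rising !(big_ord_recr, big_ord0)/=.
rewrite ?natr_ffactS ?ffactn0.
case: n n0 => // n _ /=; have n0 : n.+1%:R != 0 :> R by rewrite pnatr_eq0.
rewrite -natr1 in n0 *.
by field.
Qed.

(** The numerator of the error term uses [s * s = s]. *)
Lemma shifted_mean_sub2 n s x : (0 < n)%N -> (s <= 1)%N ->
  n%:R * shifted_mean n s x (fun t => (t - x) ^+ 2)
  = 2 * x * (1 - x) + (6 * x ^+ 2 - 4 * x - 4 * s%:R * x + 2 * s%:R) / n.+1%:R.
Proof.
move=> n0 s1.
rewrite (@eq_shifted_mean _ _ _ _
  (fun t => \sum_(i < 3) [:: x ^+ 2; - (2 * x); 1]`_i * t ^+ i)); last first.
  by move=> t _; rewrite !(big_ord_recr, big_ord0)/=; ring.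
rewrite shifted_mean_poly// !(big_ord_recr, big_ord0)/=.
rewrite !shifted_moment_explicit//.
rewrite !(big_ord_recr, big_ord0)/= !natr_rising !(big_ord_recr, big_ord0)/=.
rewrite ?natr_ffactS ?ffactn0.
case: n n0 => // n _ /=.
have : (n%:R : R) >= 0 by [].
rewrite -[n.+2%:R]natr1 -natr1; move: n%:R => N N0.
have n1 : N + 1 != 0 by lra.
have n2 : N + 1 + 1 != 0 by lra.
by case: s s1 => [|[|//]] _ /=; field; rewrite ?n1 ?n2//=; lra.
Qed.

(** Since [1 <= N], the numerator is at most
    [(24 + 480 + 648) N^2 <= 1200 N^2]. The three bounds fit the numerators of
    the fourth central moments below. *)
Lemma ler_quadratic_over_cubic (N c2 c1 c0 : R) : 1 <= N ->
  c2 <= 24 -> c1 <= 480 -> c0 <= 648 ->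
  (c2 * N ^+ 2 + c1 * N + c0) / ((N + 1) * (N + 2) * (N + 3)) <= 1200 / N.
Proof.
move=> N1 h2 h1 h0.
have K1200 : (1200 : R) >= 1152 by lra.
(* Below, only this lower bound on the constant matters, not its value. *)
move: (1200 : R) K1200 => K K1200.
rewrite ler_pdivrMr; last by rewrite !mulr_gt0//; lra.
rewrite mulrAC ler_pdivlMr; last lra.
have Nge0 : 0 <= N by lra.
apply: (@le_trans _ _ (K * N ^+ 2 * N)); last first.
  have -> : K * ((N + 1) * (N + 2) * (N + 3))
    = K * N ^+ 2 * N + K * (6 * N ^+ 2 + 11 * N + 6) by ring.
  rewrite lerDl; apply: mulr_ge0; first lra.
  by have := exprn_ge0 2 Nge0; lra.
apply: ler_wpM2r; first exact: Nge0.
have g2 : c2 * N ^+ 2 <= 24 * N ^+ 2 by rewrite ler_wpM2r// exprn_ge0.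
have g1 : c1 * N <= 480 * N by rewrite ler_wpM2r.
have NN : N <= N ^+ 2 by rewrite expr2 ler_peMl.
have KN : 1152 * N ^+ 2 <= K * N ^+ 2 by rewrite ler_wpM2r// exprn_ge0.
lra.
Qed.

(** Terms of degree 4 and 3 in [n] cancel in the numerator of the fourth
    central moment, over the denominator [n (n+1) (n+2) (n+3)]; what remains is
    a quadratic in [n] whose coefficients are polynomials in [x], bounded above
    on [[0, 1]] by adding up the positive ones. *)
Lemma shifted_mean_sub4 n s x : (0 < n)%N -> (s <= 1)%N -> 0 <= x <= 1 ->
  n%:R * shifted_mean n s x (fun t => (t - x) ^+ 4) <= 1200 / n%:R.
Proof.
move=> n0 s1 /andP[x0 x1].
rewrite (@eq_shifted_mean _ _ _ _ (fun t => \sum_(i < 5)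
  [:: x ^+ 4; - (4 * x ^+ 3); 6 * x ^+ 2; - (4 * x); 1]`_i * t ^+ i));
  last first.
  by move=> t _; rewrite !(big_ord_recr, big_ord0)/=; ring.
rewrite shifted_mean_poly// !(big_ord_recr, big_ord0)/=.
rewrite !shifted_moment_explicit//.
rewrite !(big_ord_recr, big_ord0)/= !natr_rising !(big_ord_recr, big_ord0)/=.
rewrite ?natr_ffactS ?ffactn0.
case: n n0 => // n _ /=.
have : (n.+1%:R : R) >= 1 by rewrite ler1n.
have -> : (n%:R : R) = n.+1%:R - 1 by rewrite -natr1 addrK.
move: n.+1%:R => N N1.
have y1 i : 0 <= x ^+ i <= 1 by rewrite exprn_ge0// exprn_ile1.
have N0 : N != 0 by lra.
have N2 : N + 1 != 0 by lra.
have N3 : N + 2 != 0 by lra.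
have N4 : N + 3 != 0 by lra.
have := y1 1%N; have := y1 2%N; have := y1 3%N; have := y1 4%N.
case: s s1 => [|[|//]] _ h4 h3 h2 h1.
- have c2 : 12 * x ^+ 4 - 24 * x ^+ 3 + 12 * x ^+ 2 <= 24 by lra.
  have c1 : - 180 * x ^+ 4 + 312 * x ^+ 3 - 156 * x ^+ 2 + 24 * x <= 480.
    by lra.
  have c0 : 192 * x ^+ 4 - 288 * x ^+ 3 + 144 * x ^+ 2 - 24 * x <= 648 by lra.
  apply: le_trans (ler_quadratic_over_cubic N1 c2 c1 c0).
  rewrite le_eqVlt; apply/orP; left; apply/eqP.
  by field; rewrite N0 N2 N3 N4.
- have c2 : 12 * x ^+ 4 - 24 * x ^+ 3 + 12 * x ^+ 2 <= 24 by lra.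
  have c1 : - 180 * x ^+ 4 + 408 * x ^+ 3 - 300 * x ^+ 2 + 72 * x <= 480.
    by lra.
  have c0 : 192 * x ^+ 4 - 480 * x ^+ 3 + 432 * x ^+ 2 - 168 * x + 24 <= 648.
    by lra.
  apply: le_trans (ler_quadratic_over_cubic N1 c2 c1 c0).
  rewrite le_eqVlt; apply/orP; left; apply/eqP.
  by field; rewrite N0 N2 N3 N4.
Qed.
End Moments.

(** * Decomposition of the operator and the quantitative estimate *)

Section QuantitativeVoronovskaya.
Context {R : realType}.
Implicit Types (n s k : nat) (x : R) (f g : R -> R).

(** The boundary terms of the operator are the terms [k = 0] of [V_0] and
    [k = n - 1] of [V_1]. *)
Lemma genuine_durrmeyer1E (alpha0 alpha1 : nat -> R) n f x : (0 < n)%N ->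
  genuine_durrmeyer1 alpha0 alpha1 n f x
  = alpha_fun alpha0 alpha1 x n * shifted_mean n 0 x f
    + alpha_fun alpha0 alpha1 (1 - x) n * shifted_mean n 1 x f.
Proof.
case: n => // m _; rewrite /genuine_durrmeyer1 /shifted_mean /bernstein_mean.
set a := alpha_fun _ _ x _; set b := alpha_fun _ _ (1 - x) _.
rewrite [m.+1.-1]/= [m.+1.-2]/= big_add1 [m.+1.-1]/= big_mkord.
pose I (j : nat) : R :=
  \int[lebesgue_measure]_(t in `[0, 1]) (bernstein_poly m.-1 j t * f t).
have node j : (j < m)%N -> node_functional m.+1 j.+1 f = m%:R * I j.
  by move=> jm; rewrite /node_functional /= eqSS ltn_eqF.
have -> : \sum_(j < m.+1) bernstein_poly m j x * node_functional m.+1 (j + 0) f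
    = (1 - x) ^+ m * f 0
      + m%:R * \sum_(j < m) bernstein_poly m j.+1 x * I j.
  rewrite big_ord_recl; congr (_ + _).
    by rewrite /bernstein_poly /= bin0 expr0 !mul1r subn0.
  rewrite big_distrr; apply: eq_bigr => j _ /=.
  by rewrite addn0 /bump leq0n add1n node// mulrCA.
have -> : \sum_(j < m.+1) bernstein_poly m j x * node_functional m.+1 (j + 1) f
    = x ^+ m * f 1 + m%:R * \sum_(j < m) bernstein_poly m j x * I j.
  rewrite big_ord_recr [LHS]addrC; congr (_ + _).
    rewrite /bernstein_poly /= binn subnn expr0 mulr1 mul1r.
    by rewrite /node_functional addn1 /= eqxx.
  rewrite big_distrr; apply: eq_bigr => j _ /=.
  by rewrite addn1 node// mulrCA.
have -> : \sum_(j < m) (a * bernstein_poly m j.+1 x + b * bernstein_poly m j x)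
      * I j = a * (\sum_(j < m) bernstein_poly m j.+1 x * I j)
      + b * (\sum_(j < m) bernstein_poly m j x * I j).
  by rewrite !big_distrr -big_split; apply: eq_bigr => j _ /=; ring.
by ring.
Qed.

Lemma continuous01_expr_sub x k :
  {within `[0, 1], continuous (fun t : R => (t - x) ^+ k)}.
Proof.
apply: continuous_subspaceT => t.
apply: (@continuous_comp _ _ _ (fun t => t - x) (fun t => t ^+ k)).
  by apply: cvgB; [exact: cvg_id|exact: cvg_cst].
exact: exprn_continuous.
Qed.

Lemma continuous01Z c f : {within `[0, 1], continuous f} ->
  {within `[0, 1], continuous (fun t => c * f t)}.
Proof.
move=> fc /= t; apply: (@continuousM R _ (cst c)); last exact: fc.
exact: cst_continuous.
Qed.

Lemma continuous01D f g : {within `[0, 1], continuous f} ->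
  {within `[0, 1], continuous g} ->
  {within `[0, 1], continuous (fun t => f t + g t)}.
Proof. by move=> fc gc /= t; apply: continuousD; [exact: fc|exact: gc]. Qed.

Lemma ler_norm_shifted_mean n s x f g : (0 <= x <= 1) ->
  {within `[0, 1], continuous f} -> {within `[0, 1], continuous g} ->
  (forall t, 0 <= t <= 1 -> `|f t| <= g t) ->
  `|shifted_mean n s x f| <= shifted_mean n s x g.
Proof.
move=> x01 fc gc fg; apply: ler_norm_bernstein_mean => // j _.
rewrite ler_norml -mulN1r -node_functionalZ//; apply/andP; split.
- apply: ler_node_functional => //; first exact: continuous01Z.
  by move=> t /fg; rewrite ler_norml mulN1r => /andP[].
- by apply: ler_node_functional => // t /fg; rewrite ler_norml => /andP[].
Qed.

Lemma continuous01_taylor_remainder x f c d1 d2 :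
  {within `[0, 1], continuous f} ->
  {within `[0, 1], continuous
    (fun t => f t - (c + d1 * (t - x) + d2 * (t - x) ^+ 2))}.
Proof.
move=> fc; apply: continuous01D => //; apply: continuous_subspaceT => t.
apply: cvgN; apply: cvgD; [apply: cvgD; first exact: cvg_cst|].
  by apply: cvgM; [exact: cvg_cst|apply: cvgB; [exact: cvg_id|exact: cvg_cst]].
apply: cvgM; first exact: cvg_cst.
apply: (@continuous_comp _ _ _ (fun t => t - x) (fun t => t ^+ 2)).
  by apply: cvgB; [exact: cvg_id|exact: cvg_cst].
exact: exprn_continuous.
Qed.

(** The quadratic Taylor polynomial, with arbitrary coefficients, is mapped to
    the main terms exactly, so all the error is in the remainder and in the
    [1 / (n + 1)] correction of the second moment. *)
Lemma shifted_mean_taylor n s x f d1 d2 : (0 < n)%N -> (s <= 1)%N ->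
  {within `[0, 1], continuous f} ->
  n%:R * (shifted_mean n s x f - f x)
  = d1 * (s%:R - x) + d2 * (x * (1 - x))
    + d2 * (3 * x ^+ 2 - 2 * x - 2 * s%:R * x + s%:R) / n.+1%:R
    + n%:R * shifted_mean n s x
       (fun t => f t - (f x + d1 * (t - x) + d2 / 2 * (t - x) ^+ 2)).
Proof.
move=> n0 s1 fc; set g := fun t => f t - _.
pose p k := fun t : R => (t - x) ^+ k.
have pc k : {within `[0, 1], continuous (p k)} by exact: continuous01_expr_sub.
have c0 := @continuous01Z (f x) _ (pc 0%N).
have c1 := @continuous01Z d1 _ (pc 1%N).
have c2 := @continuous01Z (d2 / 2) _ (pc 2%N).
have c12 := continuous01D c1 c2; have c012 := continuous01D c0 c12.
have gc : {within `[0, 1], continuous g}.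
  exact: continuous01_taylor_remainder.
have -> : shifted_mean n s x f = shifted_mean n s x
    (fun t => g t + (f x * p 0 t + (d1 * p 1 t + d2 / 2 * p 2 t))).
  by apply: eq_shifted_mean => t _; rewrite /g /p expr0 expr1; ring.
rewrite (shifted_meanD _ _ _ gc c012) (shifted_meanD _ _ _ c0 c12).
rewrite (shifted_meanD _ _ _ c1 c2) !shifted_meanZ//.
have -> : shifted_mean n s x (p 0) = 1.
  have -> : p 0 = fun t => t ^+ 0 by apply/funext => t; rewrite /p !expr0.
  by rewrite shifted_mean_expr// shifted_moment0.
have -> : shifted_mean n s x (p 1) = (s%:R - x) / n%:R.
  exact: shifted_mean_sub.
have n0' : n%:R != 0 :> R by rewrite pnatr_eq0 -lt0n.
have n1' : n.+1%:R != 0 :> R by rewrite pnatr_eq0.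
have := shifted_mean_sub2 x n0 s1; rewrite -/(p 2%N) => E.
move: (shifted_mean n s x (p 2)) E => q /(canRL (mulKf n0')) ->.
move: (shifted_mean _ _ _ _) (s%:R) n0' n1' => G sg.
rewrite -natr1; move: n%:R => N N0 N1.
by field; rewrite N0 N1.
Qed.

(** The estimate behind both claims, at one point and for one [n]. The numbers
    come from [V_0] and [V_1] contributing at most [C] times
    [5 `|d2| / (n + 1) + 15 e + 1200 M / n] each. *)
Lemma genuine_durrmeyer1_voronovskaya_bound (alpha0 alpha1 : nat -> R) n x f
    d1 d2 (C e M : R) : (0 < n)%N -> 0 <= x <= 1 ->
  2 * alpha0 n + alpha1 n = 1 ->
  `|alpha_fun alpha0 alpha1 x n| <= C ->
  `|alpha_fun alpha0 alpha1 (1 - x) n| <= C -> 0 <= e -> 0 <= M ->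
  {within `[0, 1], continuous f} ->
  (forall t, 0 <= t <= 1 ->
    `|f t - (f x + d1 * (t - x) + d2 / 2 * (t - x) ^+ 2)|
    <= e * (t - x) ^+ 2 + M * (t - x) ^+ 4) ->
  `|n%:R * (genuine_durrmeyer1 alpha0 alpha1 n f x - f x)
    - ((1 - 2 * x) * (1 - alpha0 n) * d1 + x * (1 - x) * d2)|
  <= C * (`|d2| * 10 / n.+1%:R + 30 * e + 2400 * M / n%:R).
Proof.
move=> n0 x01 alphaS aC bC e0 M0 fc ft.
rewrite genuine_durrmeyer1E//.
move: aC bC; set a := alpha_fun _ _ x _.
set b := alpha_fun _ _ (1 - x) _ => aC bC.
have ab : a + b = 1 by rewrite -alphaS /a /b /alpha_fun; ring.
pose g t := f t - (f x + d1 * (t - x) + d2 / 2 * (t - x) ^+ 2).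
pose r s : R := (3 * x ^+ 2 - 2 * x - 2 * s%:R * x + s%:R) / n.+1%:R.
have E0 := @shifted_mean_taylor n 0 x f d1 d2 n0 isT fc.
have E1 := @shifted_mean_taylor n 1 x f d1 d2 n0 isT fc.
rewrite -/g in E0 E1.
have -> : n%:R * (a * shifted_mean n 0 x f + b * shifted_mean n 1 x f - f x)
    - ((1 - 2 * x) * (1 - alpha0 n) * d1 + x * (1 - x) * d2)
  = a * (d2 * r 0%N + n%:R * shifted_mean n 0 x g)
    + b * (d2 * r 1%N + n%:R * shifted_mean n 1 x g).
  have -> : f x = (a + b) * f x by rewrite ab mul1r.
  have -> : n%:R * (a * shifted_mean n 0 x f + b * shifted_mean n 1 x f
      - (a + b) * f x) = a * (n%:R * (shifted_mean n 0 x f - f x))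
       + b * (n%:R * (shifted_mean n 1 x f - f x)) by ring.
  rewrite E0 E1 /r.
  have ab1 : b = 1 - a by rewrite -ab addrAC subrr add0r.
  (* The first moments: this is where [1 - alpha0 n] comes from. *)
  have a0E : (1 - 2 * x) * (1 - alpha0 n) = a * (0 - x) + b * (1 - x).
    have -> : (1 - alpha0 n) = alpha0 n + alpha1 n by rewrite -alphaS; ring.
    by rewrite /a /b /alpha_fun; ring.
  by rewrite a0E ab1 /=; ring.
have fc_g : {within `[0, 1], continuous g}.
  exact: continuous01_taylor_remainder.
have rs s : (s <= 1)%N -> `|r s| <= 5 / n.+1%:R.
  move=> s1; rewrite /r normrM [`|n.+1%:R^-1|]ger0_norm ?invr_ge0//.
  rewrite ler_wpM2r ?invr_ge0//.
  have /andP[x0 x1] := x01.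
  have : 0 <= x ^+ 2 <= 1 by rewrite exprn_ge0// exprn_ile1.
  by case: s s1 => [|[|//]] _ h; rewrite ler_norml; lra.
have Vs s : (s <= 1)%N ->
    `|n%:R * shifted_mean n s x g| <= 15 * e + 1200 * M / n%:R.
  move=> s1; rewrite normrM [`|n%:R|]ger0_norm//.
  have c2 := @continuous01Z e _ (@continuous01_expr_sub x 2).
  have c4 := @continuous01Z M _ (@continuous01_expr_sub x 4).
  have : `|shifted_mean n s x g| <= shifted_mean n s x
      (fun t => e * (t - x) ^+ 2 + M * (t - x) ^+ 4).
    apply: ler_norm_shifted_mean => //; exact: continuous01D.
  rewrite (shifted_meanD _ _ _ c2 c4) !shifted_meanZ;
    try exact: continuous01_expr_sub.
  move=> /(ler_wpM2l (ler0n R n)) /le_trans; apply.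
  rewrite mulrDr mulrCA [n%:R * (M * _)]mulrCA.
  have m4 := @shifted_mean_sub4 _ n s x n0 s1 x01.
  apply: lerD; last first.
    by rewrite (mulrC 1200) -mulrA ler_wpM2l.
  rewrite mulrC ler_wpM2r// shifted_mean_sub2//.
  have -> : (6 * x ^+ 2 - 4 * x - 4 * s%:R * x + 2 * s%:R) / n.+1%:R
    = 2 * r s by rewrite /r; ring.
  have := rs _ s1; have : 5 / n.+1%:R <= 5 :> R.
    by rewrite ler_pdivrMr// ler_peMr// ler1n.
  have /andP[x0 x1] := x01.
  have : x * (1 - x) <= 1 by rewrite mulr_ile1//; lra.
  move: (r s) (5 / n.+1%:R) => q w h1 h2; rewrite ler_norml => /andP[_ h3].
  rewrite -mulrA; move: (x * (1 - x)) h1 => y h1.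
  lra.
have A s c : (s <= 1)%N -> `|c| <= C ->
   `|c * (d2 * r s + n%:R * shifted_mean n s x g)|
   <= C * (`|d2| * 5 / n.+1%:R + 15 * e + 1200 * M / n%:R).
  move=> s1 cC; rewrite normrM; apply: ler_pM => //.
  apply: le_trans (ler_normD _ _) _; rewrite -addrA lerD//; last exact: Vs.
  by rewrite normrM -mulrA ler_wpM2l// rs.
apply: le_trans (ler_normD _ _) _.
apply: le_trans (lerD (A 0%N a isT aC) (A 1%N b isT bC)) _.
rewrite le_eqVlt; apply/orP; left; apply/eqP.
have -> : (2400 : R) = 1200 + 1200 by rewrite -natrD.
by ring.
Qed.

End QuantitativeVoronovskaya.

(** * Taylor expansion with derivatives relative to the unit interval *)

Section Taylor.
Context {R : realType}.
Implicit Types (A : set R) (f g : R -> R) (x t d e : R).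

Lemma derive_in_expansion A f x : derivable_in A f x -> forall e, 0 < e ->
  exists2 d, 0 < d & forall t, A t -> `|t - x| < d ->
    `|f t - f x - derive_in A f x * (t - x)| <= e * `|t - x|.
Proof.
move=> fx e e0.
have : diff_quotient f x y @[y --> within A x^'] --> derive_in A f x by [].
move/cvgrPdist_le => /(_ _ e0).
rewrite !near_withinE => /nbhs_ballP[d /= d0 H].
exists d => // t At td; have [->|tx] := eqVneq t x.
  by rewrite !subrr mulr0 subrr normr0 mulr0.
have tx0 : t - x != 0 by rewrite subr_eq0.
have := H t; rewrite /ball/= distrC => /(_ td tx At).
rewrite /diff_quotient => {}H.
have -> : f t - f x - derive_in A f x * (t - x) =
  - (derive_in A f x - (f t - f x) / (t - x)) * (t - x) by field.
by rewrite normrM normrN ler_wpM2r.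
Qed.

Lemma within_continuous_derivable_in A f :
  (forall x, A x -> derivable_in A f x) -> {within A, continuous f}.
Proof.
move=> fA; apply/subspace_continuousP => x /[dup] Ax /fA fx.
have [d d0 H] := derive_in_expansion fx ltr01.
apply/cvgrPdist_le => e e0; rewrite near_withinE.
pose K := `|derive_in A f x| + 1.
have K0 : 0 < K by rewrite /K ltr_wpDl.
apply/nbhs_ballP; exists (Num.min d (e / K)) => /=.
  by rewrite lt_min d0 divr_gt0.
move=> t; rewrite /ball/= distrC lt_min => /andP[td te] At.
have {}H := H _ At td.
rewrite distrC.
have -> : f t - f x = (f t - f x - derive_in A f x * (t - x))
  + derive_in A f x * (t - x) by ring.
apply: le_trans (ler_normD _ _) _; rewrite normrM.
have : K * `|t - x| <= e by rewrite mulrC -ler_pdivlMr// ltW.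
rewrite /K mulrDl; lra.
Qed.

Lemma is_derive_derive_in f x : 0 < x < 1 -> derivable_in `[0, 1] f x ->
  is_derive x 1 f (derive_in `[0, 1] f x).
Proof.
move=> /andP[x0 x1] fx.
have cv : (h^-1 *: (f (h *: 1 + x) - f x)) @[h --> 0^']
    --> derive_in `[0, 1] f x.
  apply/cvgrPdist_le => e e0; rewrite near_withinE.
  have [d d0 H] := derive_in_expansion fx e0.
  apply/nbhs_ballP; exists (Num.min d (Num.min x (1 - x))) => /=.
    by rewrite !lt_min d0 x0 subr_gt0.
  move=> h; rewrite /ball/= sub0r normrN !lt_min => /and3P[hd hx hx1] h0.
  have := H (h + x); rewrite addrK /= in_itv/= => {}H.
  have {}H : `|f (h + x) - f x - derive_in `[0, 1] f x * h| <= e * `|h|.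
    apply: H => //; move: hx hx1; rewrite !ltr_norml => /andP[? ?] /andP[? ?].
    by apply/andP; split; lra.
  rewrite -(ler_pM2r (_ : 0 < `|h|)) ?normr_gt0// -normrM.
  apply: le_trans H; rewrite -normrN le_eqVlt; apply/orP; left; apply/eqP.
  by congr (`| _ |); rewrite /GRing.scale/= mulr1; field.
apply: DeriveDef; first by apply/cvg_ex; exists (derive_in `[0, 1] f x).
exact/cvg_lim.
Qed.

(** Heine-Cantor: near each [x] a radius works for all close enough [y] and all
    small enough [d], and compactness makes the choice of [d] uniform. *)
Lemma heine_cantor01 g : {within `[0, 1], continuous g} -> forall e, 0 < e ->
  exists2 d, 0 < d & forall x t, 0 <= x <= 1 -> 0 <= t <= 1 -> `|t - x| < d ->
    `|g t - g x| <= e.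
Proof.
move=> /subspace_continuousP gc e e0.
have := @segment_compact R 0 1; rewrite compact_near_coveringP.
pose osc d x := 0 <= x <= 1 -> forall t, 0 <= t <= 1 -> `|t - x| < d ->
  `|g t - g x| <= e.
move=> /(_ R 0^'+ osc) H.
have : \forall d \near 0^'+, `[0, 1] `<=` osc d.
  apply: H => x x01.
  have e2 : 0 < e / 2 by lra.
  have := gc x x01; move/cvgrPdist_le => /(_ _ e2); rewrite near_withinE.
  move=> /nbhs_ballP[d /= d0 H].
  exists (ball x (d / 2), [set y : R | y < d / 2]) => /=.
    split; first by apply: nbhsx_ballx; lra.
    by apply: nbhs_right_lt; lra.
  move=> [y z] /= [xy zd] y01 t t01 tyz.
  have Hy : `|g x - g y| <= e / 2.
    by apply: H; rewrite /= ?in_itv//; apply: (le_ball _ xy); lra.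
  have Ht : `|g x - g t| <= e / 2.
    apply: H; rewrite /= ?in_itv//; rewrite /ball/= in xy *.
    have -> : x - t = (x - y) - (t - y) by ring.
    by apply: le_lt_trans (ler_normB _ _) _; lra.
  have -> : g t - g y = (g x - g y) - (g x - g t) by ring.
  by apply: le_trans (ler_normB _ _) _; lra.
move=> K.
have [d [d0 Kd]] : exists d : R, 0 < d /\ `[0, 1] `<=` osc d.
  near (0 : R)^'+ => d; exists d; split; first by near: d; exact: nbhs_right_gt.
  by near: d.
by exists d => // x t x01; apply: Kd => //=; rewrite in_itv.
Unshelve. all: by end_near. Qed.

Lemma continuous01_bounded g : {within `[0, 1], continuous g} ->
  exists2 K, 0 <= K & forall x, 0 <= x <= 1 -> `|g x| <= K.
Proof.
move=> gc.
have := compact_bounded (continuous_compact gc (@segment_compact R 0 1)).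
move=> [M [_ H]]; exists (`|M| + 1); first by rewrite addr_ge0.
move=> x x01; apply: (H (`|M| + 1)).
  by rewrite (le_lt_trans (ler_norm _))// ltrDl.
by exists x => //=; rewrite in_itv.
Qed.

(** Mean value theorem for [f] minus a quadratic polynomial. The coefficients
    are free, so that the lemma serves both for [f] and, with [d2 = 0], for
    its derivative. *)
Lemma MVT_remainder f x t d1 d2 e : {within `[0, 1], continuous f} ->
  0 <= x <= 1 -> 0 <= t <= 1 ->
  (forall s, Num.min x t < s < Num.max x t -> derivable_in `[0, 1] f s /\
     `|derive_in `[0, 1] f s - (d1 + d2 * (s - x))| <= e) ->
  `|f t - (f x + d1 * (t - x) + d2 / 2 * (t - x) ^+ 2)| <= e * `|t - x|.
Proof.
move=> fc x01 t01 H.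
pose h s := f s - (f x + d1 * (s - x) + d2 / 2 * (s - x) ^+ 2).
pose dh s := derive_in `[0, 1] f s - (d1 + d2 * (s - x)).
have hx : h x = 0 by rewrite /h subrr expr0n /=; ring.
have mvt a b : 0 <= a -> b <= 1 -> a < b ->
    (forall s, a < s < b -> derivable_in `[0, 1] f s) ->
    exists2 c, a < c < b & h b - h a = dh c * (b - a).
  move=> a0 b1 ab fab.
  have [s sab||c] := @MVT R h dh a b ab.
  - have [as_ sb] : a < s /\ s < b by move: sab; rewrite in_itv/= => /andP[].
    have fs : is_derive s 1 f (derive_in `[0, 1] f s).
      by apply: is_derive_derive_in; [lra|apply: fab; rewrite as_ sb].
    have q : is_derive s 1 (fun s => f x + d1 * (s - x) + d2 / 2 * (s - x) ^+ 2)
        (d1 + d2 * (s - x)).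
      by apply: is_derive_eq; rewrite /GRing.scale/=; field.
    exact: is_deriveB.
  - have /(continuous_subspaceW _) := @continuous01_taylor_remainder R x f
      (f x) d1 (d2 / 2) fc; apply.
      by move=> s /=; rewrite !in_itv/= => /andP[? ?]; apply/andP; split; lra.
  - by rewrite in_itv/= => cab ->; exists c.
have -> : f t - (f x + d1 * (t - x) + d2 / 2 * (t - x) ^+ 2) = h t - h x.
  by rewrite hx subr0.
have /andP[x0 x1] := x01; have /andP[t0 t1] := t01.
have [xt|tx|->] := ltgtP x t; last by rewrite !subrr normr0 mulr0.
- rewrite min_l ?max_r ?ltW// in H.
  have [c cxt ->] := mvt x t x0 t1 xt (fun s hs => (H s hs).1).
  by rewrite normrM ler_wpM2r//; exact: (H c cxt).2.
- rewrite min_r ?max_l ?ltW// in H.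
  have [c cxt E] := mvt t x t0 x1 tx (fun s hs => (H s hs).1).
  rewrite distrC E normrM (distrC x t) ler_wpM2r//; exact: (H c cxt).2.
Qed.

Lemma between_bounds x t s : 0 <= x <= 1 -> 0 <= t <= 1 ->
  Num.min x t < s < Num.max x t -> 0 <= s <= 1 /\ `|s - x| <= `|t - x|.
Proof.
move=> /andP[x0 x1] /andP[t0 t1]; have [xt|tx] := leP x t => /andP[s0 s1].
  rewrite !ger0_norm ?subr_ge0//; [|lra..].
  by split; [apply/andP; split|]; lra.
rewrite !ler0_norm ?subr_le0//; [|lra..].
by split; [apply/andP; split|]; lra.
Qed.

(** The expansion of [f'] at [x] bounds the derivative of the remainder by
    [e * `|s - x|]; the mean value theorem gives the second factor
    [`|t - x|]. *)
Lemma taylor_peano_at f x : {within `[0, 1], continuous f} -> 0 <= x <= 1 ->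
  derivable2_in `[0, 1] f x -> forall e, 0 < e ->
  exists2 d, 0 < d & forall t, 0 <= t <= 1 -> `|t - x| < d ->
    `|f t - (f x + derive_in `[0, 1] f x * (t - x)
             + derive2_in `[0, 1] f x / 2 * (t - x) ^+ 2)| <= e * (t - x) ^+ 2.
Proof.
move=> fc x01 [nf f2] e e0.
have [d1 d10 H1] := derive_in_expansion f2 e0.
move: nf; rewrite near_withinE => /nbhs_ballP[d2 /= d20 H2].
exists (Num.min d1 d2); first by rewrite lt_min d10.
move=> t t01; rewrite lt_min => /andP[td1 td2].
have -> : e * (t - x) ^+ 2 = (e * `|t - x|) * `|t - x|.
  by rewrite -real_normK ?num_real// expr2 mulrA.
apply: MVT_remainder => // s st.
have [s01 sx] : 0 <= s <= 1 /\ `|s - x| <= `|t - x|.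
  exact: between_bounds.
split.
  by apply: H2; rewrite /= ?in_itv// /ball/= distrC; exact: le_lt_trans td2.
rewrite opprD addrA.
apply: (@le_trans _ _ (e * `|s - x|)); last by rewrite ler_wpM2l// ltW.
by apply: H1; rewrite /= ?in_itv//; exact: le_lt_trans td1.
Qed.

(** As in the pointwise case, but the expansion of [f'] with a uniform radius is
    itself obtained from the mean value theorem and the uniform continuity of
    [f'']. *)
Lemma taylor_peano_uniform f : {within `[0, 1], continuous f} ->
  (forall x, 0 <= x <= 1 -> derivable2_in `[0, 1] f x) ->
  {within `[0, 1], continuous (derive2_in `[0, 1] f)} -> forall e, 0 < e ->
  exists2 d, 0 < d & forall x t, 0 <= x <= 1 -> 0 <= t <= 1 -> `|t - x| < d ->
    `|f t - (f x + derive_in `[0, 1] f x * (t - x)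
             + derive2_in `[0, 1] f x / 2 * (t - x) ^+ 2)| <= e * (t - x) ^+ 2.
Proof.
move=> fc f2 f2c e e0; have [d d0 H] := heine_cantor01 f2c e0.
exists d => // x t x01 t01 td.
have df y : 0 <= y <= 1 -> derivable_in `[0, 1] f y.
  move=> y01; have [nf _] := f2 y y01.
  move: nf; rewrite near_withinE => /nbhs_singleton; apply.
  by rewrite /= in_itv.
have ddf y : 0 <= y <= 1 -> derivable_in `[0, 1] (derive_in `[0, 1] f) y.
  by move=> y01; have [_] := f2 y y01.
have dfc : {within `[0, 1], continuous (derive_in `[0, 1] f)}.
  by apply: within_continuous_derivable_in => y /=; rewrite in_itv/= => /ddf.
have -> : e * (t - x) ^+ 2 = (e * `|t - x|) * `|t - x|.
  by rewrite -real_normK ?num_real// expr2 mulrA.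
apply: MVT_remainder => // s st.
have [s01 sx] : 0 <= s <= 1 /\ `|s - x| <= `|t - x|.
  exact: between_bounds.
split; first exact: df.
apply: (@le_trans _ _ (e * `|s - x|)); last by rewrite ler_wpM2l// ltW.
have := @MVT_remainder (derive_in `[0, 1] f) x s (derive2_in `[0, 1] f x) 0 e
  dfc x01 s01.
rewrite mul0r mul0r addr0 opprD addrA; apply => r rs.
have [r01 rx] : 0 <= r <= 1 /\ `|r - x| <= `|s - x|.
  exact: between_bounds.
split; first exact: ddf.
rewrite mul0r addr0; apply: H => //.
by rewrite (le_lt_trans rx)// (le_lt_trans sx).
Qed.

End Taylor.

(** * The Voronovskaya formula *)

Section Voronovskaya.
Context {R : realType}.

Lemma bounded_alpha_fun (alpha0 alpha1 : nat -> R) :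
  [bounded alpha0 n | n in [set n | (0 < n)%N]] ->
  [bounded alpha1 n | n in [set n | (0 < n)%N]] ->
  exists2 C, 0 < C & forall n x, (0 < n)%N -> 0 <= x <= 1 ->
    `|alpha_fun alpha0 alpha1 x n| <= C.
Proof.
move=> [M0 [_ H0]] [M1 [_ H1]].
exists ((`|M1| + 1) + (`|M0| + 1)); first by rewrite ltr_wpDr// ltr_wpDl.
move=> n x n0 /andP[x0 x1]; apply: le_trans (ler_normD _ _) _; apply: lerD.
- rewrite normrM (ger0_norm x0).
  have /= := H1 (`|M1| + 1) _ n n0; rewrite ltr_pwDr ?ler_norm// => /(_ isT).
  by apply: le_trans; rewrite ler_piMr.
- have /= := H0 (`|M0| + 1) _ n n0.
  by rewrite ltr_pwDr ?ler_norm// => /(_ isT).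
Qed.

(** Convergence uniform on [S], from data uniform on [S]: bounded coefficients
    and a Peano remainder whose radius does not depend on the point. The error
    is split in three parts, each at most [e / 4]: the limit of [alpha0], the
    Peano part, and the part of order [1 / n]. *)
Lemma genuine_durrmeyer1_voronovskaya_on (S : set R) (alpha0 alpha1 : nat -> R)
    (l0 D : R) (f d1 d2 : R -> R) :
  [bounded alpha0 n | n in [set n | (0 < n)%N]] ->
  [bounded alpha1 n | n in [set n | (0 < n)%N]] ->
  alpha0 n @[n --> \oo] --> l0 ->
  (forall n, (0 < n)%N -> 2 * alpha0 n + alpha1 n = 1) ->
  {within `[0, 1], continuous f} ->
  (forall x, S x -> [/\ 0 <= x <= 1, `|d1 x| <= D & `|d2 x| <= D]) ->
  (forall e, 0 < e -> exists2 d, 0 < d &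
    forall x t, S x -> 0 <= t <= 1 -> `|t - x| < d ->
    `|f t - (f x + d1 x * (t - x) + d2 x / 2 * (t - x) ^+ 2)|
    <= e * (t - x) ^+ 2) ->
  forall e, 0 < e -> \forall n \near \oo, forall x, S x ->
    `|n%:R * (genuine_durrmeyer1 alpha0 alpha1 n f x - f x)
      - ((1 - 2 * x) * (1 - l0) * d1 x + x * (1 - x) * d2 x)| <= e.
Proof.
move=> ba0 ba1 cva alphaS fc Sd peano e e0.
have [C C0 alphaC] := bounded_alpha_fun ba0 ba1.
have [K K0 fK] := continuous01_bounded fc.
have [S0|/set0P[x0 Sx0]] := eqVneq S set0.
  by near=> n => x; rewrite S0.
have D0 : 0 <= D by have [_ + _] := Sd _ Sx0; exact: le_trans.
pose eps := e / (4 * (30 * C)).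
have C30 : 0 < 30 * C by lra.
have eps0 : 0 < eps by rewrite divr_gt0//; lra.
have [d d0 Pd] := peano _ eps0.
(* The remainder is at most [2 K + 2 D] everywhere on [[0, 1]]. *)
pose M := (2 * K + 2 * D) / d ^+ 4.
have M0 : 0 <= M by apply: divr_ge0; [lra|rewrite exprn_ge0// ltW].
have remainder x t : S x -> 0 <= t <= 1 ->
    `|f t - (f x + d1 x * (t - x) + d2 x / 2 * (t - x) ^+ 2)|
    <= eps * (t - x) ^+ 2 + M * (t - x) ^+ 4.
  move=> Sx t01; have [td|td] := ltP `|t - x| d.
    apply: le_trans (Pd _ _ Sx t01 td) _; rewrite lerDl mulr_ge0//.
    by rewrite exprn_even_ge0.
  have [x01 d1D d2D] := Sd _ Sx.
  apply: (@le_trans _ _ (2 * K + 2 * D)); last first.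
    apply: (@le_trans _ _ (M * (t - x) ^+ 4)); last first.
      by rewrite lerDr mulr_ge0 ?exprn_even_ge0// ltW.
    rewrite /M mulrAC ler_pdivlMr ?exprn_gt0// ler_wpM2l//; first lra.
    rewrite -[leRHS]ger0_norm ?exprn_even_ge0// normrX.
    by rewrite lerXn2r// ?nnegrE// ltW.
  have tx1 : `|t - x| <= 1.
    by rewrite ler_norml; move: t01 x01 => /andP[? ?] /andP[? ?];
      apply/andP; split; lra.
  apply: le_trans (ler_normB _ _) _.
  have : `|f t| <= K by exact: fK.
  have : `|f x + d1 x * (t - x) + d2 x / 2 * (t - x) ^+ 2| <= K + D + D.
    apply: le_trans (ler_normD _ _) _; apply: lerD.
      apply: le_trans (ler_normD _ _) _; apply: lerD; first exact: fK.
      by rewrite normrM -[D]mulr1; apply: ler_pM.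
    rewrite normrM -[leRHS]mulr1; apply: ler_pM => //.
      rewrite normrM [`|2^-1|]ger0_norm ?invr_ge0//.
      by have := normr_ge0 (d2 x); lra.
    by rewrite normrX exprn_ile1.
  lra.
(* Below, only the sign of the constant matters, not its value. *)
have [L LE] : exists L, L = 2400 * M by exists (2400 * M).
have L0 : 0 <= L by lra.
have nbig : \forall n \near \oo,
    4 * C * (10 * D + L) / e + 1 <= n%:R by exact: nbhs_infty_ger.
have D1 : 0 < D + 1 by lra.
have e4 : 0 < e / 4 / (D + 1) by rewrite !divr_gt0.
move/cvgrPdist_le : cva => /(_ _ e4) nalpha.
near=> n => x Sx; have [x01 d1D d2D] := Sd _ Sx.
have n1 : 4 * C * (10 * D + L) / e + 1 <= n%:R by near: n.
have n_gt0 : 0 < n%:R :> R.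
  apply: lt_le_trans n1; apply: ltr_wpDl; last exact: ltr01.
  by apply: divr_ge0; [apply: mulr_ge0|]; lra.
have n0 : (0 < n)%N by rewrite ltr0n in n_gt0.
have an : `|l0 - alpha0 n| <= e / 4 / (D + 1) by near: n.
have xc : 0 <= 1 - x <= 1 by move: x01 => /andP[? ?]; apply/andP; split; lra.
have := @genuine_durrmeyer1_voronovskaya_bound R alpha0 alpha1 n x f
  (d1 x) (d2 x) C eps M n0 x01 (alphaS n n0) (alphaC n x n0 x01)
  (alphaC n (1 - x) n0 xc) (ltW eps0) M0 fc (fun t => @remainder x t Sx).
rewrite -LE.
set U := n%:R * _ => HU.
have -> : U - ((1 - 2 * x) * (1 - l0) * d1 x + x * (1 - x) * d2 x)
  = (U - ((1 - 2 * x) * (1 - alpha0 n) * d1 x + x * (1 - x) * d2 x))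
   + (1 - 2 * x) * d1 x * (l0 - alpha0 n) by ring.
apply: le_trans (ler_normD _ _) _.
have T1 : `|(1 - 2 * x) * d1 x * (l0 - alpha0 n)| <= e / 4.
  have -> : e / 4 = 1 * (D + 1) * (e / 4 / (D + 1)) by field; rewrite gt_eqF.
  rewrite !normrM; apply: ler_pM => //.
  apply: ler_pM => //; last lra.
  by rewrite ler_norml; move: x01 => /andP[? ?]; apply/andP; split; lra.
have T2 : C * (30 * eps) = e / 4.
  by rewrite /eps; field; rewrite gt_eqF.
have T3 : C * (`|d2 x| * 10 / n.+1%:R + L / n%:R) <= e / 4.
  apply: (@le_trans _ _ (C * ((10 * D + L) / n%:R))).
    apply: ler_wpM2l; first exact: ltW.
    rewrite [leRHS]mulrDl lerD2r; apply: ler_pM => //; last first.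
      by rewrite lef_pV2 ?posrE// ler_nat.
    by rewrite mulrC ler_wpM2l.
  rewrite mulrA ler_pdivrMr//.
  have : 4 * C * (10 * D + L) / e <= n%:R by lra.
  by rewrite ler_pdivrMr//; lra.
apply: le_trans (lerD HU T1) _.
have -> : C * (`|d2 x| * 10 / n.+1%:R + 30 * eps + L / n%:R)
  = C * (30 * eps) + C * (`|d2 x| * 10 / n.+1%:R + L / n%:R) by ring.
rewrite T2; apply: le_trans (lerD (lerD (lexx _) T3) (lexx _)) _; lra.
Unshelve. all: by end_near. Qed.

End Voronovskaya.

Theorem theorem2p3 (R : realType) (alpha0 alpha1 : nat -> R) (l0 : R)
    (bounded_alpha0 : [bounded alpha0 n | n in [set n | (0 < n)%N]])
    (bounded_alpha1 : [bounded alpha1 n | n in [set n | (0 < n)%N]])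
    (cvg_alpha0 : alpha0 n @[n --> \oo] --> l0)
    (cvg_alpha1 : cvg (alpha1 n @[n --> \oo]))
    (alpha_sum : forall n : nat, (0 < n)%N -> 2 * alpha0 n + alpha1 n = 1)
    (alpha_neg : forall n : nat, (0 < n)%N ->
       alpha0 n < 0 \/ alpha0 n + alpha1 n < 0)
    (f : R -> R) (f_cont : {within `[0, 1], continuous f}) :
  (forall x : R, x \in `[0, 1] -> derivable2_in `[0, 1] f x ->
     n%:R * (genuine_durrmeyer1 alpha0 alpha1 n f x - f x) @[n --> \oo] -->
       (1 - 2 * x) * (1 - l0) * derive_in `[0, 1] f x
       + x * (1 - x) * derive2_in `[0, 1] f x)
  /\
  ((forall x : R, x \in `[0, 1] -> derivable2_in `[0, 1] f x) ->
   {within `[0, 1], continuous (derive2_in `[0, 1] f)} ->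
   {uniform `[0, 1], (fun (n : nat) (x : R) =>
        n%:R * (genuine_durrmeyer1 alpha0 alpha1 n f x - f x)) @ \oo -->
      (fun x : R => (1 - 2 * x) * (1 - l0) * derive_in `[0, 1] f x
         + x * (1 - x) * derive2_in `[0, 1] f x)}).
Proof.
split.
- move=> x; rewrite in_itv/= => x01 fx; apply/cvgrPdist_le => e e0.
  pose d1 := derive_in `[0, 1] f; pose d2 := derive2_in `[0, 1] f.
  have := @genuine_durrmeyer1_voronovskaya_on R [set x] alpha0 alpha1 l0
    (`|d1 x| + `|d2 x|) f d1 d2 bounded_alpha0 bounded_alpha1 cvg_alpha0
    alpha_sum f_cont _ _ e e0 => H.
  have near_e : \forall n \near \oo, forall y, [set x] y ->
    `|n%:R * (genuine_durrmeyer1 alpha0 alpha1 n f y - f y)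
      - ((1 - 2 * y) * (1 - l0) * d1 y + y * (1 - y) * d2 y)| <= e.
    apply: H.
    + by move=> y ->; split; rewrite // ?lerDl ?lerDr.
    + move=> eps /(taylor_peano_at f_cont x01 fx)[d d0 H].
      by exists d => // y t ->; exact: H.
  by apply: filterS near_e => n /(_ x erefl); rewrite distrC.
- move=> f2 f2c.
  have f2' x : 0 <= x <= 1 -> derivable2_in `[0, 1] f x.
    by move=> x01; apply: f2; rewrite in_itv.
  have dfc : {within `[0, 1], continuous (derive_in `[0, 1] f)}.
    apply: within_continuous_derivable_in => y /=; rewrite in_itv/= => /f2'.
    by case.
  have [K1 _ H1] := continuous01_bounded dfc.
  have [K2 _ H2] := continuous01_bounded f2c.
  move=> P /uniform_nbhs[E [+ EP]]; rewrite -entourage_ballE => -[e /= e0 eE].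
  have e2 : 0 < e / 2 by lra.
  have := @genuine_durrmeyer1_voronovskaya_on R `[0, 1] alpha0 alpha1 l0
    (Num.max K1 K2) f _ _ bounded_alpha0 bounded_alpha1 cvg_alpha0
    alpha_sum f_cont _ _ _ e2.
  move=> /(_ (derive_in `[0, 1] f) (derive2_in `[0, 1] f)) H.
  apply: filterS (H _ _) => [n Hn||].
  - apply: EP => y y01; apply: eE; rewrite /= /ball/= distrC.
    by apply: le_lt_trans (Hn _ y01) _; lra.
  - move=> y /=; rewrite in_itv/= => y01.
    by split; rewrite // le_max ?H1 ?H2 ?orbT.
  - move=> eps /(taylor_peano_uniform f_cont f2' f2c)[d d0 Hd].
    by exists d => // y t /=; rewrite in_itv/=; exact: Hd.
Qed.
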